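(* Let $d\ge 3$, $1\le t\le d$, $R\ge 1$, let $\mathcal A\in\mathbb R^{n_1\times\cdots\times n_d}$, and let $U_1,\ldots,U_d$ be generated by Algorithm 1 (described in the context) applied to $\mathcal A$ with parameters $R,t$. Let $\beta_j=n_j^{-1}$ if $2\le j\le d-1$, and $\beta_j=1$ if $j=1$. (i) If for all $j=d-t+1,\ldots,d-1$ and $i=1,\ldots,R$ the vectors $\mathbf v_{j,i}$ are generated deterministically by Procedure A or Procedure B, then $$G(U_1,\ldots,U_d)\ \ge\ \frac{1}{\zeta(d-t)^2}\prod_{j=d-t+1}^{d-1}\frac{\beta_j}{R}\cdot\sum_{i=1}^R\lambda_i(A_{(d)})^2\ \ge\ \frac{1}{\zeta(d-t)^2}\prod_{j=d-t+1}^{d-1}\frac{\beta_j}{R}\cdot G_{\max}.$$ (ii) If the vectors $\mathbf v_{j,i}$ are generated randomly by Procedure C, then $$\mathsf E\, G(U_1,\ldots,U_d)\ \ge\ \frac{1}{\zeta(d-t)^2}\prod_{j=d-t+1}^{d-1}\frac{\beta_j}{R}\cdot\sum_{i=1}^R\lambda_i(A_{(d)})^2\ \ge\ \frac{1}{\zeta(d-t)^2}\prod_{j=d-t+1}^{d-1}\frac{\beta_j}{R}\cdot G_{\max}.$$ The ratio $\frac{1}{\zeta(d-t)^2}\prod_{j=d-t+1}^{d-1}\frac{\beta_j}{R}$ equals $$\frac{1}{R^{d-1}\prod_{j=2}^{d-1}n_j}\ \text{ if } t=d,\qquad \frac{1}{R^{t-1}\,\zeta(d-t)^2\,\prod_{j=d-t+1}^{d-1}n_j}\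 \text{ if } 1\le t<d.$$
   Context: **Notation.** Inner products of tensors are entrywise sums of products, $\|\cdot\|_F$ is the Frobenius norm, $\bigotimes_{j=1}^d\mathbf u_j$ is the rank-one tensor $\mathbf u_1\otimes\cdots\otimes\mathbf u_d$, and $\mathcal A\times_j\mathbf u^\top$ is the contraction of mode $j$ of $\mathcal A$ with $\mathbf u$ (removing that mode). $A_{(j)}\in\mathbb R^{n_j\times\prod_{k\ne j}n_k}$ is the mode-$j$ unfolding of $\mathcal A$, and $\lambda_i(\cdot)$ is the $i$-th largest singular value of a matrix. Empty products equal $1$. **Problem.** For $U_j=[\mathbf u_{j,1},\ldots,\mathbf u_{j,R}]\in\mathbb R^{n_j\times R}$ let $G(U_1,\ldots,U_d)=\sum_{i=1}^R\langle\mathcal A,\bigotimes_{j=1}^d\mathbf u_{j,i}\rangle^2$. $G_{\max}$ is the maximum of $G$ subject to $\mathbf u_{j,i}^\top\mathbf u_{j,i}=1$ for $1\le j\le d-t$, $1\le i\le R$, and $U_j^\top U_j=I$ for $d-t+1\le j\le d$. It is assumed that $R\le n_j$ for $d-t+1\le j\le d$, so that the problem is feasible. **Polar decomposition.** A polar decomposition of $V\in\mathbb R^{m\times n}$, $m\ge n$, is $V=UH$ with $U\in\mathbb R^{m\times n}$, $U^\top U=I$, and $H$ symmetric positive semidefinite ($U$ need not be unique if $V$ is rank deficient). **Algorithm 1** (input $\mathcal A$, $d\ge3$, $R\ge1$, $t\ge 1$). 1. $\mathbf u_{d,1},\ldots,\mathbf u_{d,R}$ are orthonormal left singular vectors of $A_{(d)}$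 belonging to its $R$ largest singular values; $U_d=[\mathbf u_{d,1},\ldots,\mathbf u_{d,R}]$. 2. For $j=d-1,d-2,\ldots,d-t+1$: for each $i=1,\ldots,R$ put $\mathcal B_{j,i}=\mathcal A\times_{j+1}\mathbf u_{j+1,i}^\top\times_{j+2}\cdots\times_d\mathbf u_{d,i}^\top\in\mathbb R^{n_1\times\cdots\times n_j}$. If $j>1$, let $M_{j,i}\in\mathbb R^{n_j\times\prod_{k=1}^{j-1}n_k}$ be the mode-$j$ unfolding of $\mathcal B_{j,i}$ and obtain $\mathbf v_{j,i}\in\mathbb R^{n_j}$ from $M_{j,i}$ by one of the Procedures A, B, C below; if $j=1$, let $\mathbf v_{1,i}=\mathcal B_{1,i}$. Put $V_j=[\mathbf v_{j,1},\ldots,\mathbf v_{j,R}]$ and let $U_j=[\mathbf u_{j,1},\ldots,\mathbf u_{j,R}]$ be the orthonormal factor of a polar decomposition of $V_j$. 3. If $t<d$: for each $i$, let $(\mathbf u_{1,i},\ldots,\mathbf u_{d-t,i})=\mathtt{rank1approx}(\mathcal A\times_{d-t+1}\mathbf u_{d-t+1,i}^\top\times\cdots\times_d\mathbf u_{d,i}^\top)$ (unit vectors), and $U_j=[\mathbf u_{j,1},\ldots,\mathbf u_{j,R}]$ for $1\le j\le d-t$. **Procedures** (from $M\in\mathbb R^{n\times m}$ produce $\mathbf v\in\mathbb R^n$); $M^k$ denotes the $k$-th row. - A: $\mathbf y$ is a unit leading right singular vector of $M$; $\mathbf v=M\mathbf y$. - B: $\bar k$ is the first index with $\|M^{\bar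 k}\|=\max_k\|M^k\|$; $\mathbf y=M^{\bar k}/\|M^{\bar k}\|$ (as a vector of $\mathbb R^m$); $\mathbf v=M\mathbf y$. - C: $\bar k$ is drawn uniformly at random from $\{1,\ldots,n\}$; $\mathbf y=M^{\bar k}/\|M^{\bar k}\|$; $\mathbf v=M\mathbf y$. If the selected row in B or C is zero, $\mathbf y$ is taken to be an arbitrary unit vector. With Procedure C, each $\bar k$ drawn at stage $j$ is uniform conditionally on the outcome of the previous stages $d-1,\ldots,j+1$, and $\mathsf E$ is the expectation over all these random choices. **rank1approx.** For $m\ge1$, $\mathtt{rank1approx}$ is a procedure that for every $\mathcal C\in\mathbb R^{n_1\times\cdots\times n_m}$ returns unit vectors $\mathbf x_j\in\mathbb R^{n_j}$ with $\langle\mathcal C,\bigotimes_{j=1}^m\mathbf x_j\rangle\ge\|\mathcal C\|_F/\zeta(m)$, where $1/\zeta(m)\in(0,1]$ is its guaranteed approximation factor for tensors of this size. By convention $\zeta(0)=1$. *)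

(* Defs.v *)
From HB Require Import structures.
From mathcomp Require Import all_boot all_order all_algebra.
From mathcomp Require Import all_classical all_reals all_analysis.

Set Implicit Arguments.
Unset Strict Implicit.
Unset Printing Implicit Defensive.

Import Order.TTheory GRing.Theory Num.Theory.

Local Open Scope classical_set_scope.
Local Open Scope ring_scope.

(* Modes are numbered from 1: [n j] is the dimension of mode [j], and an
   order-[m] tensor has modes 1, ..., m.  The other values of [n] are unused,
   and so are the values outside the relevant range of all families indexed by
   modes below.  Indices inside a mode, and indices of components, singular
   values and rows, start from 0. *)

(* The index set [n_1] x ... x [n_m], nested to the left. *)
Fixpoint midx (n : nat -> nat) (m : nat) : finType :=
  if m is m'.+1 then (midx n m' * 'I_(n m'.+1))%type else unit.

Definition tensor (R : realType) (n : nat -> nat) (m : nat) : Type :=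
  midx n m -> R.

Definition tinner (R : realType) n m (S T : tensor R n m) : R :=
  \sum_(x : midx n m) S x * T x.

Definition tnorm (R : realType) n m (T : tensor R n m) : R :=
  Num.sqrt (tinner T T).

(* u_1 (x) ... (x) u_m *)
Fixpoint rank1 (R : realType) n (u : forall j, 'cV[R]_(n j)) (m : nat) :
    tensor R n m :=
  match m return tensor R n m with
  | 0%N => fun=> 1
  | m'.+1 => fun x => @rank1 R n u m' x.1 * u m'.+1 x.2 0
  end.
Arguments rank1 {R n} u m _.

(* T x_{m+1} u^T, for the last mode; the algorithm only contracts last modes. *)
Definition contract (R : realType) n m (T : tensor R n m.+1)
    (u : 'cV[R]_(n m.+1)) : tensor R n m :=
  fun x => \sum_(a < n m.+1) T (x, a) * u a 0.

(* The mode-m unfolding of an order-m tensor.  The columns are indexed by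
   [n_1] x ... x [n_{m-1}] in its enumeration order. *)
Definition unfold (R : realType) n m :
    tensor R n m -> 'M[R]_(n m, #|{: midx n m.-1}|) :=
  match m return tensor R n m -> 'M[R]_(n m, #|{: midx n m.-1}|) with
  | 0%N => fun=> 0
  | m'.+1 => fun T => \matrix_(a, c) T (enum_val c, a)
  end.

Definition vec_of_tensor (R : realType) n (T : tensor R n 1) : 'cV[R]_(n 1) :=
  \col_a T (tt, a).

Definition unit_vec (R : realType) p (u : 'cV[R]_p) : Prop :=
  u^T *m u = 1%:M.

Definition row_norm (R : realType) m p (M : 'M[R]_(m, p)) (k : 'I_m) : R :=
  Num.sqrt (\sum_l M k l ^+ 2).

(* M = W diag(s) Z^T is a full singular value decomposition.  The sequence of
   singular values is extended by 0 past [minn m p]. *)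
Definition is_svd (R : realType) m p (M : 'M[R]_(m, p))
    (W : 'M[R]_m) (s : nat -> R) (Z : 'M[R]_p) : Prop :=
  [/\ W^T *m W = 1%:M,
      Z^T *m Z = 1%:M,
      M = W *m (\matrix_(i < m, j < p) (s i *+ (i == j :> nat))) *m Z^T,
      (forall i, 0 <= s i /\ s i.+1 <= s i) &
      forall i, (minn m p <= i)%N -> s i = 0].

(* [sing_val M i] is the (i+1)-th largest singular value of M.  The sequence
   [s] of an SVD is uniquely determined by M. *)
Definition sing_val (R : realType) m p (M : 'M[R]_(m, p)) : nat -> R :=
  xget (fun=> 0) [set s | exists W Z, is_svd M W s Z].

(* The columns of U are orthonormal left singular vectors of M belonging to
   its r largest singular values. *)
Definition leading_left_vectors (R : realType) m p r (M : 'M[R]_(m, p))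
    (U : 'M[R]_(m, r)) : Prop :=
  exists (W : 'M[R]_m) (s : nat -> R) (Z : 'M[R]_p), is_svd M W s Z /\
    forall (i : 'I_r) (k : 'I_m), k = i :> nat -> col i U = col k W.

Definition leading_right_vector (R : realType) m p (M : 'M[R]_(m, p))
    (y : 'cV[R]_p) : Prop :=
  exists (W : 'M[R]_m) (s : nat -> R) (Z : 'M[R]_p) (k : 'I_p),
    [/\ is_svd M W s Z, k = 0%N :> nat & y = col k Z].

Definition psd (R : realType) p (H : 'M[R]_p) : Prop :=
  H^T = H /\ forall x : 'cV[R]_p, 0 <= (x^T *m H *m x) 0 0.

(* U is an orthonormal factor of some polar decomposition V = U H. *)
Definition polar_factor (R : realType) m p (V U : 'M[R]_(m, p)) : Prop :=
  U^T *m U = 1%:M /\ exists H : 'M[R]_p, psd H /\ V = U *m H.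

(* y is the k-th row of M, normalized; any unit vector if that row is 0. *)
Definition row_direction (R : realType) m p (M : 'M[R]_(m, p)) (k : 'I_m)
    (y : 'cV[R]_p) : Prop :=
  (row k M != 0 -> y = (row_norm M k)^-1 *: (row k M)^T) /\
  (row k M = 0 -> unit_vec y).

Definition procA (R : realType) m p (M : 'M[R]_(m, p)) (v : 'cV[R]_m) : Prop :=
  exists y, leading_right_vector M y /\ v = M *m y.

Definition procB (R : realType) m p (M : 'M[R]_(m, p)) (v : 'cV[R]_m) : Prop :=
  exists k y, [/\ forall l, row_norm M l <= row_norm M k,
    forall l : 'I_m, (l < k)%N -> row_norm M l < row_norm M k,
    row_direction M k y & v = M *m y].

(* Procedure C once the row [kbar] has been drawn. *)
Definition procC (R : realType) (kbar : nat) m p (M : 'M[R]_(m, p))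
    (v : 'cV[R]_m) : Prop :=
  exists k y, [/\ nat_of_ord k = kbar, row_direction M k y & v = M *m y].

(* How v_{j,i} is obtained from B_{j,i}: through the procedure [proc] applied
   to the mode-j unfolding if j > 1, directly if j = 1. *)
Definition stage_vector (R : realType) n
    (proc : forall m p, 'M[R]_(m, p) -> 'cV[R]_m -> Prop) (j : nat) :
    tensor R n j -> 'cV[R]_(n j) -> Prop :=
  match j return tensor R n j -> 'cV[R]_(n j) -> Prop with
  | 1%N => fun T v => v = vec_of_tensor T
  | _ => fun T v => proc _ _ (unfold T) v
  end.

(* [x m C] are the vectors returned by rank1approx on the order-m tensor C;
   [zeta m] is the inverse of the guaranteed approximation factor. *)
Definition rank1approx_guarantee (R : realType) n m (zeta : R)
    (x : tensor R n m -> forall j, 'cV[R]_(n j)) : Prop :=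
  0 < zeta^-1 <= 1 /\
  forall C : tensor R n m,
    (forall j, (1 <= j <= m)%N -> unit_vec (x C j)) /\
    tinner C (rank1 (x C) m) >= tnorm C / zeta.

(* (U_1, ..., U_d) is an output of the algorithm, where v_{j,i} is generated
   by [proc j i] and B j i = A x_{j+1} u_{j+1,i}^T ... x_d u_{d,i}^T. *)
Definition algorithm1 (R : realType) n d r t (A : tensor R n d)
    (rk1 : forall m, tensor R n m -> forall j, 'cV[R]_(n j))
    (proc : nat -> 'I_r -> forall m p, 'M[R]_(m, p) -> 'cV[R]_m -> Prop)
    (U : forall j, 'M[R]_(n j, r)) : Prop :=
  exists B : forall j, 'I_r -> tensor R n j,
    [/\ (forall i, B d i = A) /\
        (forall j i, (j < d)%N ->
           B j i = contract (B j.+1 i) (col i (U j.+1))),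
        leading_left_vectors (unfold A) (U d),
        forall j, (d - t + 1 <= j <= d - 1)%N ->
          exists V : 'M[R]_(n j, r),
            (forall i, stage_vector (proc j i) (B j i) (col i V)) /\
            polar_factor V (U j) &
        (t < d)%N -> forall i j, (1 <= j <= d - t)%N ->
          col i (U j) = rk1 (d - t)%N (B (d - t)%N i) j].

Definition Gfun (R : realType) n d r (A : tensor R n d)
    (U : forall j, 'M[R]_(n j, r)) : R :=
  \sum_(i < r) tinner A (rank1 (fun j => col i (U j)) d) ^+ 2.

Definition feasible (R : realType) n d r t (U : forall j, 'M[R]_(n j, r)) :
    Prop :=
  (forall j i, (1 <= j <= d - t)%N -> unit_vec (col i (U j))) /\
  (forall j, (d - t + 1 <= j <= d)%N -> (U j)^T *m U j = 1%:M).

(* The maximum is attained (continuity on a compact set), so it is the sup. *)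
Definition Gmax (R : realType) n d (r t : nat) (A : tensor R n d) : R :=
  sup [set Gfun A U | U in [set U : forall j, 'M[R]_(n j, r) | feasible d t U]].

Definition stage_beta (R : realType) (n : nat -> nat) (j : nat) : R :=
  if j == 1%N then 1 else (n j)%:R^-1.

Definition approx_ratio (R : realType) (n : nat -> nat) (d r t : nat)
    (zeta : nat -> R) : R :=
  1 / zeta (d - t)%N ^+ 2 *
  \prod_(d - t + 1 <= j < d) (stage_beta R n j / r%:R).

Definition sum_sq_sing_val (R : realType) m p (r : nat) (M : 'M[R]_(m, p)) : R :=
  \sum_(i < r) sing_val M i ^+ 2.

(* Draws are made only at the stages j = d-1, ..., max(2, d-t+1). *)
Definition draw_stage (d t j : nat) : bool :=
  (2 <= j)%N && (d - t + 1 <= j <= d - 1)%N.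

(* The draw kbar_{j,i} is uniform on the n_j row indices conditionally on every
   outcome h of the draws of the previous stages (those of index > j).  No
   independence between the draws of a same stage is required. *)
Definition uniform_draws (R : realType) (disp : measure_display)
    (Omega : measurableType disp) (P : probability Omega R)
    (n : nat -> nat) (d r t : nat)
    (kbar : nat -> 'I_r -> {RV P >-> nat}) : Prop :=
  forall (j : nat) (i : 'I_r) (h : nat -> 'I_r -> nat) (a : nat),
    draw_stage d t j -> (a < n j)%N ->
    let past := [set w | forall j' i', (j < j')%N -> draw_stage d t j' ->
                           kbar j' i' w = h j' i'] in
    P (past `&` [set w | kbar j i w = a]) = (P past * ((n j)%:R^-1)%:E)%E.

(* All randomness comes from the draws, and U_j is determined by the draws made
   up to stage j: the free choices of the algorithm (singular vectors, polar
   factors, unit vectors replacing zero rows) do not anticipate later draws. *)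
Definition nonanticipative (R : realType) (disp : measure_display)
    (Omega : measurableType disp) (P : probability Omega R)
    (n : nat -> nat) (d r t : nat)
    (kbar : nat -> 'I_r -> {RV P >-> nat})
    (U : Omega -> forall j, 'M[R]_(n j, r)) : Prop :=
  forall j w w', (d - t + 1 <= j <= d)%N ->
    (forall j' i, (j <= j')%N -> draw_stage d t j' ->
       kbar j' i w = kbar j' i w') ->
    U w j = U w' j.

(* Main.v *)
Require Import Defs.
From HB Require Import structures.
From mathcomp Require Import all_boot all_order all_algebra.
From mathcomp Require Import ring lra zify.
From mathcomp Require Import all_classical all_reals all_analysis.
From mathcomp Require Import measurable_realfun.

(** Write [B j i] for the tensor obtained from [A] by contracting the modes above
    [j] with the i-th columns of the computed factors, and let the mass at level
    [j] be the sum over [i] of the squared norms of the [B j i].  The mass at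
    level [d - 1] is the sum of the [r] largest squared singular values of the
    last unfolding, by the choice of [U d].

    A stage [j] loses at most the factor [stage_beta n j / r].  The vectors
    [v_i = M_i y_i] satisfy [|v_i|^2 >= stage_beta n j * |B j i|^2]: for a leading
    right singular vector because the largest squared singular value is at least
    the average of [n j] of them, for the longest row because its squared norm is
    at least the average over all rows, and for a uniformly drawn row in
    expectation; at [j = 1] the vector is the tensor itself and nothing is lost
    here.  If [V = U H] is the polar decomposition of the matrix of the
    [v_i], then [<u_i, v_i> = H i i], and these diagonal entries satisfy
    [\sum_i H i i ^+ 2 >= (\tr H)^2 / r >= |H|^2 / r = |V|^2 / r]
    since [H] is positive semidefinite; finally the new mass is the sum of the
    [|M_i^T u_i|^2 >= <u_i, v_i>^2] (lemma [polar_factor_gain]).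

    At the end, the rank-one approximations of the remaining tensors cost the
    factor [1 / zeta (d - t) ^+ 2] ([Gfun_ge_mass]).  For the comparison with the
    maximum, at a feasible point the objective is at most the squared norm of the
    product of the transposed last unfolding with a matrix that has orthonormal
    columns, which Ky Fan's principle bounds by the same sum of squared singular
    values ([ky_fan], [Gmax_le]).

    In the random case, the tensors [B j i] are functions of the draws made before
    stage [j].  These draws take finitely many values, and conditionally on them
    the draw at stage [j] is uniform, so that the expected squared norm of the
    drawn slice is [1 / n j] times the expected squared norm of the tensor
    ([integral_uniform_pick], [expected_mass_stage]). *)

Set Implicit Arguments.
Unset Strict Implicit.
Unset Printing Implicit Defensive.

Import Order.TTheory GRing.Theory Num.Theory.

Local Open Scope classical_set_scope.
Local Open Scope ring_scope.

(** * Squared Frobenius norms *)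

Lemma cauchy_schwarz_sum (R : realType) (I : finType) (a b : I -> R) :
  (\sum_i a i * b i) ^+ 2 <= (\sum_i a i ^+ 2) * (\sum_i b i ^+ 2).
Proof.
have h : 0 <= \sum_i \sum_j (a i * b j - a j * b i) ^+ 2.
  by apply: sumr_ge0 => i _; apply: sumr_ge0 => j _; exact: sqr_ge0.
suff e : \sum_i \sum_j (a i * b j - a j * b i) ^+ 2 =
    (\sum_i a i ^+ 2) * (\sum_i b i ^+ 2) *+ 2 - (\sum_i a i * b i) ^+ 2 *+ 2.
  by move: h; rewrite e; lra.
have e1 : (\sum_i a i ^+ 2) * (\sum_i b i ^+ 2) =
    \sum_i \sum_j a i ^+ 2 * b j ^+ 2.
  by rewrite big_distrl/=; apply: eq_bigr => i _; rewrite big_distrr.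
have e2 : (\sum_i a i * b i) ^+ 2 = \sum_i \sum_j (a i * b i) * (a j * b j).
  by rewrite expr2 big_distrl/=; apply: eq_bigr => i _; rewrite big_distrr.
rewrite mulr2n {1}e1 [X in _ + X - _](_ : _ = \sum_i \sum_j a j ^+ 2 * b i ^+ 2);
  last by rewrite e1 exchange_big.
rewrite e2 -sumrMnl -big_split -sumrB; apply: eq_bigr => i _ /=.
rewrite -sumrMnl -big_split -sumrB; apply: eq_bigr => j _ /=.
ring.
Qed.

(** The squared Frobenius norm; on column vectors, the squared Euclidean norm. *)
Definition sqnorm (R : realType) m p (M : 'M[R]_(m, p)) : R :=
  \sum_i \sum_j M i j ^+ 2.

Lemma sqnorm_ge0 (R : realType) m p (M : 'M[R]_(m, p)) : 0 <= sqnorm M.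
Proof. by apply: sumr_ge0 => i _; apply: sumr_ge0 => j _; exact: sqr_ge0. Qed.

Lemma sqnorm_mxtrace (R : realType) m p (M : 'M[R]_(m, p)) :
  sqnorm M = \tr (M^T *m M).
Proof.
rewrite /sqnorm /mxtrace exchange_big; apply: eq_bigr => j _.
by rewrite mxE; apply: eq_bigr => i _; rewrite mxE expr2.
Qed.

Lemma sqnorm_col (R : realType) m (v : 'cV[R]_m) :
  sqnorm v = \sum_i v i 0 ^+ 2.
Proof. by apply: eq_bigr => i _; rewrite big_ord1. Qed.

Lemma sqnorm_sum_col (R : realType) m p (M : 'M[R]_(m, p)) :
  sqnorm M = \sum_j sqnorm (col j M).
Proof.
rewrite /sqnorm exchange_big; apply: eq_bigr => j _; rewrite -/(sqnorm _).
by rewrite sqnorm_col; apply: eq_bigr => i _; rewrite mxE.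
Qed.

Lemma unit_vec_sqnorm (R : realType) p (u : 'cV[R]_p) :
  unit_vec u <-> sqnorm u = 1.
Proof.
rewrite sqnorm_mxtrace /mxtrace big_ord1; split; first by move=> ->; rewrite mxE eqxx.
by move=> e; apply/matrixP => i j; rewrite !ord1 e mxE eqxx.
Qed.

Lemma sqnorm_isometry (R : realType) m k p (W : 'M[R]_(m, k)) (M : 'M[R]_(k, p)) :
  W^T *m W = 1%:M -> sqnorm (W *m M) = sqnorm M.
Proof.
by move=> hW; rewrite !sqnorm_mxtrace trmx_mul mulmxA -(mulmxA M^T) hW mulmx1.
Qed.

Lemma unit_vec_col (R : realType) m p (U : 'M[R]_(m, p)) (i : 'I_p) :
  U^T *m U = 1%:M -> unit_vec (col i U).
Proof.
move=> h; apply/matrixP => a b; rewrite !ord1.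
have := congr1 (fun X : 'M[R]_p => X i i) h; rewrite !mxE eqxx => <-.
by apply: eq_bigr => k _; rewrite !mxE.
Qed.

(** The left-hand side is the squared inner product of [M^T u] with the unit
    vector [y], so this is Cauchy--Schwarz. *)
Lemma sqr_dot_le_sqnorm (R : realType) m p (M : 'M[R]_(m, p)) (u : 'cV[R]_m) (y : 'cV[R]_p) :
  unit_vec y -> ((u^T *m (M *m y)) 0 0) ^+ 2 <= sqnorm (M^T *m u).
Proof.
move=> /unit_vec_sqnorm hy.
rewrite -[leRHS]mulr1 -hy !sqnorm_col.
apply: le_trans (cauchy_schwarz_sum _ _).
rewrite mulmxA -[u^T *m M]trmxK trmx_mul trmxK [X in X ^+ 2]mxE.
by under eq_bigr do rewrite mxE.
Qed.

(** * Positive semidefinite matrices and polar factors *)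

(** The quadratic form of [H] on [a e_i + b e_j] is nonnegative for all [a] and
    [b], so the 2 x 2 principal minor at [i, j] is nonnegative. *)
Lemma psd_entry_sqr (R : realType) p (H : 'M[R]_p) (i j : 'I_p) :
  psd H -> H i j ^+ 2 <= H i i * H j j.
Proof.
move=> [hs hp].
have q (a b : R) : 0 <= a ^+ 2 * H i i + (a * b * H i j) *+ 2 + b ^+ 2 * H j j.
  pose x : 'cV[R]_p := a *: delta_mx i 0 + b *: delta_mx j 0.
  have := hp x.
  have hji : H j i = H i j by rewrite -{1}hs mxE.
  suff -> : (x^T *m H *m x) 0 0 =
      a ^+ 2 * H i i + (a * b * H i j) *+ 2 + b ^+ 2 * H j j by [].
  have bil (k l : 'I_p) : ((delta_mx k (0 : 'I_1))^T *m H *m delta_mx l (0 : 'I_1)) 0 0 = H k l.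
    by rewrite trmx_delta -rowE -colE !mxE.
  have xT : x^T = a *: (delta_mx i 0)^T + b *: (delta_mx j 0)^T.
    by rewrite /x linearD/= !linearZ.
  rewrite xT /x !mulmxDl !mulmxDr -!scalemxAl -!scalemxAr.
  have addE (X Y : 'M[R]_1) : (X + Y) 0 0 = X 0 0 + Y 0 0 by rewrite mxE.
  have sclE c (X : 'M[R]_1) : (c *: X) 0 0 = c * X 0 0 by rewrite mxE.
  rewrite !(addE, sclE) !bil hji; ring.
have hii : 0 <= H i i by have := q 1 0; lra.
(* The point [a = - H i j], [b = H i i] minimizes the form up to scaling if
   [H i i] is positive.  If [H i i] is zero, the form takes the value
   [- H i j ^+ 2 * (H j j + 2)] at [a = - (H j j + 1)], [b = H i j]. *)
have [h0|hn0] := eqVneq (H i i) 0; last first.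
  have hlt : 0 < H i i by rewrite lt_def hn0.
  have := q (- H i j) (H i i).
  suff -> : (- H i j) ^+ 2 * H i i + (- H i j * H i i * H i j) *+ 2 + H i i ^+ 2 * H j j
     = H i i * (H i i * H j j - H i j ^+ 2) by rewrite pmulr_rge0// subr_ge0.
  ring.
rewrite h0 mul0r.
have := q (- (H j j + 1)) (H i j); rewrite h0.
have := q 0 1.
set x := H i j; set y := H j j => hy hq.
have hy' : 0 <= y by lra.
have hx := sqr_ge0 x.
have hxy : 0 <= x ^+ 2 * y by rewrite mulr_ge0.
move: hq; rewrite (_ : _ + _ = - (x ^+ 2 * y) - x ^+ 2 *+ 2); first lra.
by ring.
Qed.

(** The Frobenius norm is at most the nuclear norm.  Summing the bounds on the
    entries avoids eigenvalues. *)
Lemma psd_sqnorm_le_trace (R : realType) p (H : 'M[R]_p) :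
  psd H -> sqnorm H <= (\tr H) ^+ 2.
Proof.
move=> hH; rewrite expr2 /mxtrace big_distrl; apply: ler_sum => i _ /=.
by rewrite big_distrr; apply: ler_sum => j _ /=; exact: psd_entry_sqr.
Qed.

Lemma sum_sqr_ge (R : realType) r (a : 'I_r -> R) : (0 < r)%N ->
  r%:R^-1 * (\sum_i a i) ^+ 2 <= \sum_i a i ^+ 2.
Proof.
move=> hr; have := cauchy_schwarz_sum a (fun _ => 1).
under eq_bigr do rewrite mulr1.
rewrite [X in _ * X](_ : _ = r%:R); last first.
  by rewrite -[in RHS](card_ord r) -sum1_card natr_sum; apply: eq_bigr => i _; rewrite expr1n.
by move=> h; rewrite mulrC ler_pdivrMr// ltr0n.
Qed.

(** The gain of one stage.  Since [U^T V = H], the inner product of the i-th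
    columns of [U] and [V] is [H i i], and as [M i y i] is the i-th column of
    [V], its square is a lower bound for the squared norm of [(M i)^T u_i].  Summing over [i],
    Cauchy--Schwarz loses the factor [r] in passing to [(\tr H)^2], which
    dominates the squared norm of [H], that is, of [V = U H]. *)
Lemma polar_factor_gain (R : realType) m r (q : nat) (V U : 'M[R]_(m, r))
    (M : 'I_r -> 'M[R]_(m, q)) (y : 'I_r -> 'cV[R]_q) :
  (0 < r)%N -> polar_factor V U ->
  (forall i, unit_vec (y i)) -> (forall i, col i V = M i *m y i) ->
  r%:R^-1 * sqnorm V <= \sum_i sqnorm ((M i)^T *m col i U).
Proof.
move=> hr [hU [H [hH hV]]] hy hVM.
have hd i : H i i = ((col i U)^T *m (M i *m y i)) 0 0.
  have -> : H = U^T *m V by rewrite hV mulmxA hU mul1mx.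
  by rewrite -hVM !mxE; apply: eq_bigr => k _; rewrite !mxE.
have h1 : \sum_i H i i ^+ 2 <= \sum_i sqnorm ((M i)^T *m col i U).
  by apply: ler_sum => i _; rewrite hd; exact: sqr_dot_le_sqnorm.
apply: le_trans h1; apply: le_trans (sum_sqr_ge _ hr).
rewrite ler_wpM2l ?invr_ge0//.
by rewrite hV sqnorm_isometry//; exact: psd_sqnorm_le_trace.
Qed.

(** * Singular values and Ky Fan's principle *)

Lemma sqnorm_tr (R : realType) m p (M : 'M[R]_(m, p)) : sqnorm M^T = sqnorm M.
Proof.
rewrite /sqnorm exchange_big; apply: eq_bigr => i _; apply: eq_bigr => j _.
by rewrite mxE.
Qed.

(** With [M = W D Z^T], the squared norm of [M^T U] is that of [D^T (W^T U)],
    because [Z] is an isometry; [D D^T] is diagonal with entries [s k ^+ 2],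
    also for [k] past the number of columns, where [s k] vanishes. *)
Lemma svd_sqnorm_mul (R : realType) m p r (M : 'M[R]_(m, p)) W s Z (U : 'M[R]_(m, r)) :
  is_svd M W s Z ->
  sqnorm (M^T *m U) = \sum_(k < m) s k ^+ 2 * \sum_i (W^T *m U) k i ^+ 2.
Proof.
move=> [_ hZ -> _ hs0]; set D := (X in W *m X *m _).
have hDD : D *m D^T = diag_mx (\row_k (s k ^+ 2)).
  apply/matrixP => a b; rewrite !mxE.
  have [hap|hpa] := ltnP a p; last first.
    rewrite big1 => [|l _]; last first.
      by rewrite !mxE (gtn_eqF (leq_trans (ltn_ord l) hpa)) mulr0n mul0r.
    by rewrite (hs0 a) ?geq_min ?hpa ?orbT// expr0n mul0rn.
  rewrite (bigD1 (Ordinal hap))//= big1 => [|l hl]; last first.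
    rewrite !mxE (_ : (a == l :> nat) = false) ?mulr0n ?mul0r//.
    by apply: contraNF hl => /eqP e; apply/eqP/val_inj.
  rewrite addr0 !mxE/= eqxx mulr1n (eq_sym (b : nat)) -[in RHS]val_eqE.
  by case: eqVneq => [e|]; rewrite ?mulr0n ?mulr0// !mulr1n -e expr2.
rewrite !trmx_mul trmxK -!mulmxA sqnorm_isometry//.
set Q := W^T *m U.
rewrite sqnorm_mxtrace trmx_mul trmxK -!mulmxA (mulmxA D) hDD /mxtrace.
under eq_bigr do rewrite mxE.
rewrite exchange_big; apply: eq_bigr => k _; rewrite big_distrr.
apply: eq_bigr => i _ /=; rewrite mul_diag_mx !mxE/=; ring.
Qed.

Lemma svd_sqnorm (R : realType) m p (M : 'M[R]_(m, p)) W s Z :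
  is_svd M W s Z -> sqnorm M = \sum_(k < m) s k ^+ 2.
Proof.
move=> h; have hW : W^T *m W = 1%:M by case: h.
have := svd_sqnorm_mul W h.
rewrite -sqnorm_tr trmx_mul trmxK sqnorm_isometry; last first.
  by rewrite trmxK; exact: mulmx1C.
move=> ->; apply: eq_bigr => k _.
rewrite hW (bigD1 k)//= big1 => [|i hi]; first by rewrite mxE eqxx addr0 expr1n mulr1.
by rewrite mxE eq_sym (negPf hi) expr0n.
Qed.

(** [P = Q Q^T] is an orthogonal projection: its diagonal entry [P k k] is the
    sum over row [k] of the squares of the entries of [P], hence at least
    [P k k ^+ 2]. *)
Lemma orthonormal_row_le1 (R : realType) m r (Q : 'M[R]_(m, r)) (k : 'I_m) :
  Q^T *m Q = 1%:M -> \sum_i Q k i ^+ 2 <= 1.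
Proof.
move=> hQ; pose P := Q *m Q^T.
have hP : P *m P^T = P by rewrite /P trmx_mul trmxK mulmxA -(mulmxA Q) hQ mulmx1.
have hk : \sum_i Q k i ^+ 2 = P k k.
  by rewrite mxE; apply: eq_bigr => i _; rewrite mxE expr2.
have : P k k ^+ 2 <= P k k.
  have e : P k k = \sum_l P k l ^+ 2.
    have := congr1 (fun X : 'M[R]_m => X k k) hP; rewrite mxE => {1}<-.
    by apply: eq_bigr => l _; rewrite [P^T l k]mxE -expr2.
  by rewrite [leRHS]e (bigD1 k)//= lerDl; apply: sumr_ge0 => l _; exact: sqr_ge0.
rewrite hk; nra.
Qed.

Lemma svd_nonincreasing (R : realType) m p (M : 'M[R]_(m, p)) W s Z (i j : nat) :
  is_svd M W s Z -> (i <= j)%N -> s j <= s i.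
Proof.
move=> [_ _ _ hs _] /subnK <-; elim: (j - i)%N => [//|k ih].
by rewrite addSn (le_trans _ ih)// (hs _).2.
Qed.

(** Ky Fan's maximum principle.  The squared norm of [M^T U] is the sum of
    [c k * s k ^+ 2] with weights [c k] in [0, 1] of total [r]; as [s] is
    nonincreasing, putting the whole weight on the first [r] indices is best. *)
Lemma ky_fan (R : realType) m p r (M : 'M[R]_(m, p)) W s Z (U : 'M[R]_(m, r)) :
  is_svd M W s Z -> (r <= m)%N -> U^T *m U = 1%:M ->
  sqnorm (M^T *m U) <= \sum_(i < r) s i ^+ 2.
Proof.
move=> h hrm hU; rewrite (svd_sqnorm_mul U h).
have hW : W^T *m W = 1%:M by case: h.
set Q := W^T *m U.
have hQ : Q^T *m Q = 1%:M.
  by rewrite trmx_mul trmxK mulmxA -(mulmxA U^T) (mulmx1C hW) mulmx1.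
pose c (k : 'I_m) := \sum_i Q k i ^+ 2; pose e (k : 'I_m) : R := (k < r)%N%:R.
have hc : \sum_k c k = r%:R.
  by rewrite -[LHS]/(sqnorm Q) sqnorm_mxtrace hQ mxtrace1.
have eE (f : nat -> R) : \sum_(k < m) f k * e k = \sum_(i < r) f i.
  rewrite (big_ord_widen m f hrm) [RHS]big_mkcond; apply: eq_bigr => k _.
  by rewrite /e; case: ifP; rewrite ?mulr1 ?mulr0.
have he : \sum_k e k = r%:R.
  transitivity (\sum_(k < m) 1 * e k); first by apply: eq_bigr => k _; rewrite mul1r.
  by rewrite (eE (fun=> 1)) sumr_const card_ord.
rewrite -(eE (fun k => s k ^+ 2)) -subr_ge0 -sumrB.
(* Termwise comparison with the threshold [s r]: below [r] the weight can only
   have decreased from 1, from [r] on it can only have increased from 0. *)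
have e0 : 0 = \sum_k s r ^+ 2 * (e k - c k).
  by rewrite -big_distrr sumrB /= he hc subrr mulr0.
rewrite [leLHS]e0.
apply: ler_sum => k _; rewrite -mulrBr -/(c k) -subr_ge0 -mulrBl.
have c0 : 0 <= c k by apply: sumr_ge0 => i _; exact: sqr_ge0.
have c1 : c k <= 1 by exact: orthonormal_row_le1.
have s0 i : 0 <= s i by case: h => _ _ _ hs _; exact: (hs i).1.
rewrite /e; case: ltnP => hk.
  rewrite mulr_ge0// ?subr_ge0// ler_sqr ?nnegrE//.
  exact: (svd_nonincreasing h (ltnW hk)).
rewrite sub0r mulr_le0// ?oppr_le0// subr_le0 ler_sqr ?nnegrE//.
exact: (svd_nonincreasing h hk).
Qed.

Lemma leading_left_orthonormal (R : realType) m p r (M : 'M[R]_(m, p)) (U : 'M[R]_(m, r)) :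
  (r <= m)%N -> leading_left_vectors M U -> U^T *m U = 1%:M.
Proof.
move=> hrm [W [s [Z [[hW _ _ _ _] hU]]]].
have -> : U = colsub (widen_ord hrm) W.
  apply/matrixP => a b; have := hU b (widen_ord hrm b) erefl.
  by move=> /colP/(_ a); rewrite !mxE.
apply/matrixP => a b.
have := congr1 (fun X : 'M[R]_m => X (widen_ord hrm a) (widen_ord hrm b)) hW.
rewrite !mxE => e; rewrite -val_eqE /= in e *; rewrite -e.
by apply: eq_bigr => k _; rewrite !mxE.
Qed.

(** [sing_val] is chosen by the axiom of choice among all decompositions, so an
    existing decomposition guarantees that it belongs to one. *)
Lemma sing_val_svd (R : realType) m p r (M : 'M[R]_(m, p)) (U : 'M[R]_(m, r)) :
  leading_left_vectors M U -> exists W Z, is_svd M W (sing_val M) Z.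
Proof.
move=> [W [s [Z [h _]]]].
have : [set s | exists W Z, is_svd M W s Z] (sing_val M).
  by apply: xgetPex; exists s, W, Z.
by [].
Qed.

(** The vectors [U] come from some singular value decomposition, whereas
    [sing_val] belongs to a possibly different one.  Applying Ky Fan to each
    decomposition against the left singular vectors of the other one shows that
    the two sums agree. *)
Lemma sqnorm_leading_left (R : realType) m p r (M : 'M[R]_(m, p)) (U : 'M[R]_(m, r)) :
  (r <= m)%N -> leading_left_vectors M U ->
  sqnorm (M^T *m U) = sum_sq_sing_val r M.
Proof.
move=> hrm hl; have hU := leading_left_orthonormal hrm hl.
have [W' [Z' h']] := sing_val_svd hl; case: hl => W [s [Z [h hUW]]].
have sqE W1 s1 Z1 (U1 : 'M[R]_(m, r)) : is_svd M W1 s1 Z1 ->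
    (forall i : 'I_r, forall k : 'I_m, k = i :> nat -> col i U1 = col k W1) ->
    sqnorm (M^T *m U1) = \sum_(i < r) s1 i ^+ 2.
  move=> h1 hU1; rewrite (svd_sqnorm_mul U1 h1).
  have hW1 : W1^T *m W1 = 1%:M by case: h1.
  have hQ k i : (W1^T *m U1) k i = (k == i :> nat)%:R.
    have := congr1 (fun X : 'M[R]_m => X k (widen_ord hrm i)) hW1.
    rewrite !mxE -val_eqE /= => <-.
    have := hU1 i (widen_ord hrm i) erefl => /colP e.
    by apply: eq_bigr => l _; have := e l; rewrite !mxE => ->.
  rewrite (big_ord_widen m (fun i => s1 i ^+ 2) hrm) [RHS]big_mkcond.
  apply: eq_bigr => k _; case: ltnP => hk.
    rewrite (bigD1 (Ordinal hk))//= big1 => [|i hi].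
      by rewrite hQ eqxx expr1n addr0 mulr1.
    by rewrite hQ (_ : (k == i :> nat) = false) ?expr0n// eq_sym; apply/negbTE.
  rewrite big1 ?mulr0// => i _.
  by rewrite hQ gtn_eqF ?expr0n// (leq_trans (ltn_ord i) hk).
apply/le_anti/andP; split; first exact: ky_fan h' hrm hU.
pose U' : 'M[R]_(m, r) := colsub (widen_ord hrm) W'.
have hU' : forall i : 'I_r, forall k : 'I_m, k = i :> nat -> col i U' = col k W'.
  move=> i k e; apply/colP => a; rewrite !mxE; congr (W' _ _); exact: val_inj.
rewrite /sum_sq_sing_val -(sqE _ _ _ U' h' hU') (sqE _ _ _ U h hUW).
apply: (ky_fan h hrm); apply: (@leading_left_orthonormal _ _ _ _ M) => //.
by exists W', (sing_val M), Z'.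
Qed.

(** * Right singular vectors and rows *)

(** [M y] has squared norm [s 0 ^+ 2], the largest of the [m] terms whose sum is
    the squared norm of [M]. *)
Lemma leading_right_bound (R : realType) m p (M : 'M[R]_(m, p)) (y : 'cV[R]_p) :
  leading_right_vector M y -> unit_vec y /\ m%:R^-1 * sqnorm M <= sqnorm (M *m y).
Proof.
move=> [W [s [Z [k [h hk ->]]]]]; have [hW hZ hM hs _] := h.
split; first exact: unit_vec_col.
case: m => [|m] in M W h hW hM *; first by rewrite invr0 mul0r sqnorm_ge0.
have -> : sqnorm (M *m col k Z) =
    sqnorm (col k (\matrix_(i < m.+1, j < p) (s i *+ (i == j :> nat)))).
  rewrite hM -mulmxA colE (mulmxA Z^T) hZ mul1mx -mulmxA sqnorm_isometry//.
  by rewrite colE.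
apply: (@le_trans _ _ (s 0 ^+ 2)).
  rewrite (svd_sqnorm h) mulrC ler_pdivrMr ?ltr0n//.
  apply: (@le_trans _ _ (\sum_(k < m.+1) s 0%N ^+ 2)).
    apply: ler_sum => i _; rewrite ler_sqr ?nnegrE ?(hs _).1//.
    exact: (svd_nonincreasing h).
  by rewrite sumr_const card_ord mulr_natr.
rewrite sqnorm_col big_ord_recl !mxE/= hk eqxx mulr1n lerDl.
by apply: sumr_ge0 => i _; exact: sqr_ge0.
Qed.

Lemma row_normE (R : realType) m p (M : 'M[R]_(m, p)) k :
  row_norm M k ^+ 2 = sqnorm (row k M).
Proof.
rewrite sqr_sqrtr; last by apply: sumr_ge0 => i _; exact: sqr_ge0.
by rewrite /sqnorm big_ord1; apply: eq_bigr => i _; rewrite mxE.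
Qed.

Lemma sqnorm_sum_row (R : realType) m p (M : 'M[R]_(m, p)) :
  sqnorm M = \sum_k sqnorm (row k M).
Proof.
by apply: eq_bigr => k _; rewrite /sqnorm big_ord1; apply: eq_bigr => i _; rewrite mxE.
Qed.

Lemma sqnorm_eq0 (R : realType) m p (M : 'M[R]_(m, p)) : sqnorm M = 0 -> M = 0.
Proof.
move=> h; apply/matrixP => i j; rewrite mxE; apply/eqP; rewrite -sqrf_eq0; apply/eqP.
have h1 : \sum_j M i j ^+ 2 = 0.
  by apply: (psumr_eq0P _ h) => // k _; apply: sumr_ge0 => l _; exact: sqr_ge0.
by apply: (psumr_eq0P _ h1) => // k _; exact: sqr_ge0.
Qed.

(** The k-th coordinate of [M y] is the norm of the k-th row when that row is
    nonzero; when it is zero, any [y] will do. *)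
Lemma row_direction_bound (R : realType) m p (M : 'M[R]_(m, p)) k (y : 'cV[R]_p) :
  row_direction M k y -> unit_vec y /\ sqnorm (row k M) <= sqnorm (M *m y).
Proof.
move=> [h1 h0]; have [hk|hk] := eqVneq (row k M) 0.
  split; first exact: h0.
  rewrite hk (_ : sqnorm 0 = 0) ?sqnorm_ge0//.
  by rewrite /sqnorm big1// => i _; rewrite big1// => j _; rewrite mxE expr0n.
have {h1 h0} hy := h1 hk.
have hn : row_norm M k != 0.
  by apply: contra_neq hk => e; apply: sqnorm_eq0; rewrite -row_normE e expr0n.
split.
  apply/unit_vec_sqnorm; rewrite hy sqnorm_col.
  under eq_bigr do rewrite 3!mxE exprMn.
  rewrite -big_distrr /= exprVn -(mulVf (_ : row_norm M k ^+ 2 != 0)) ?sqrf_eq0//.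
  congr (_ * _); rewrite row_normE /sqnorm big_ord1.
  by apply: eq_bigr => i _; rewrite mxE.
rewrite -row_normE [leRHS]sqnorm_col (bigD1 k)//=.
have -> : (M *m y) k 0 = row_norm M k.
  rewrite hy -scalemxAr 2!mxE.
  have -> : \sum_j M k j * (row k M)^T j 0 = row_norm M k ^+ 2.
    rewrite row_normE /sqnorm big_ord1.
    by apply: eq_bigr => i _; rewrite !mxE expr2.
  by rewrite expr2 mulKf.
by rewrite lerDl; apply: sumr_ge0 => i _; exact: sqr_ge0.
Qed.

Lemma longest_row_bound (R : realType) m p (M : 'M[R]_(m, p)) (k : 'I_m) :
  (forall l, row_norm M l <= row_norm M k) ->
  m%:R^-1 * sqnorm M <= sqnorm (row k M).
Proof.
move=> hk; have m0 : (0 < m)%N by apply: leq_trans (ltn_ord k).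
rewrite mulrC ler_pdivrMr ?ltr0n// sqnorm_sum_row.
apply: (@le_trans _ _ (\sum_(l < m) sqnorm (row k M))).
  by apply: ler_sum => l _; rewrite -!row_normE ler_sqr ?nnegrE ?sqrtr_ge0.
by rewrite sumr_const card_ord mulr_natr.
Qed.

(** * Tensors, contractions and the upper bound *)

Lemma big_midx0 (R : realType) n (f : midx n 0 -> R) : \sum_x f x = f tt.
Proof. by rewrite (bigD1 (tt : midx n 0))//= big1 ?addr0// => -[]. Qed.

Lemma big_midxS (R : realType) n m (f : midx n m.+1 -> R) :
  \sum_x f x = \sum_(c : midx n m) \sum_(a < n m.+1) f (c, a).
Proof. by rewrite pair_big /=; apply: eq_bigr => -[]. Qed.

Lemma big_enum_val_midx (R : realType) n m (f : midx n m -> R) :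
  \sum_x f x = \sum_(c < #|{: midx n m}|) f (enum_val c).
Proof. by rewrite -[RHS](big_enum_val (A := {: midx n m}) f). Qed.

Lemma tinner_unfold (R : realType) n m (T : tensor R n m.+1) :
  tinner T T = sqnorm (unfold T).
Proof.
rewrite /tinner big_midxS /sqnorm exchange_big; apply: eq_bigr => a _.
rewrite big_enum_val_midx; apply: eq_bigr => c _; by rewrite mxE expr2.
Qed.

Lemma tinner_contract (R : realType) n m (T : tensor R n m.+1) u :
  tinner (Defs.contract T u) (Defs.contract T u) = sqnorm ((unfold T)^T *m u).
Proof.
rewrite /tinner big_enum_val_midx sqnorm_col; apply: eq_bigr => c _.
rewrite -expr2 mxE; congr (_ ^+ 2); apply: eq_bigr => a _; by rewrite !mxE.
Qed.

(** Contracting the last mode is adjoint to tensoring with a vector; iterated,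
    this turns the objective into one about the partial contractions. *)
Lemma tinner_rank1S (R : realType) n m (T : tensor R n m.+1)
    (u : forall j, 'cV[R]_(n j)) :
  tinner T (rank1 u m.+1) = tinner (Defs.contract T (u m.+1)) (rank1 u m).
Proof.
rewrite /tinner big_midxS; apply: eq_bigr => c _.
by rewrite /Defs.contract big_distrl; apply: eq_bigr => a _ /=; rewrite mulrAC mulrA.
Qed.

Lemma eq_rank1 (R : realType) n m (u v : forall j, 'cV[R]_(n j)) :
  (forall j, (1 <= j <= m)%N -> u j = v j) -> rank1 u m = rank1 v m.
Proof.
elim: m => [//|m ih] h; apply/funext => x /=; rewrite h ?leqnn// ih// => j /andP[j1 jm].
by rewrite h// j1 ltnW.
Qed.

Lemma tinner_rank1_unit (R : realType) n m (u : forall j, 'cV[R]_(n j)) :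
  (forall j, (1 <= j <= m)%N -> unit_vec (u j)) ->
  tinner (rank1 u m) (rank1 u m) = 1.
Proof.
elim: m => [|m ih] h; first by rewrite /tinner big_midx0 mulr1.
rewrite /tinner big_midxS /=.
rewrite -[RHS]ih; last by move=> j /andP[j1 jm]; apply: h; rewrite j1 ltnW.
apply: eq_bigr => c _; have /unit_vec_sqnorm := h m.+1 (leqnn _).
rewrite sqnorm_col => e; rewrite -[RHS]mulr1 -[X in _ = _ * X]e big_distrr.
apply: eq_bigr => a _ /=; ring.
Qed.

Lemma tinner_sqr_le (R : realType) n m (S T : tensor R n m) :
  tinner T T = 1 -> tinner S T ^+ 2 <= tinner S S.
Proof.
move=> hT; rewrite -[leRHS]mulr1 -hT.
(* Squares are definitionally products. *)
exact: cauchy_schwarz_sum.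
Qed.

Lemma tinner_ge0 (R : realType) n m (S : tensor R n m) : 0 <= tinner S S.
Proof. by apply: sumr_ge0 => x _; rewrite -expr2 sqr_ge0. Qed.

Lemma sum_tinner_contract (R : realType) n m r (T : tensor R n m.+1)
    (U : 'M[R]_(n m.+1, r)) :
  \sum_i tinner (Defs.contract T (col i U)) (Defs.contract T (col i U)) =
  sqnorm ((unfold T)^T *m U).
Proof.
rewrite [RHS]sqnorm_sum_col; apply: eq_bigr => i _.
by rewrite tinner_contract !colE mulmxA.
Qed.

(** The first [d] modes of the rank-one tensors have norm 1, so only the
    contraction along the last mode matters for an upper bound. *)
Lemma Gfun_le (R : realType) n d t r (A : tensor R n d.+1) U :
  (1 <= t)%N -> feasible d.+1 t U ->
  Gfun (r := r) A U <= sqnorm ((unfold A)^T *m U d.+1).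
Proof.
move=> t1 [h1 h2]; rewrite -sum_tinner_contract; apply: ler_sum => i _.
rewrite tinner_rank1S; apply: tinner_sqr_le; apply: tinner_rank1_unit => j /andP[j1 jd].
have [hj|hj] := leqP j (d.+1 - t); first by apply: h1; rewrite j1.
by apply: unit_vec_col; apply: h2; rewrite addn1 hj leqW.
Qed.

(** Orthonormality of the last factor and Ky Fan's principle.  If the feasible
    set is empty, the supremum is 0 and the bound still holds. *)
Lemma Gmax_le (R : realType) n d t r (A : tensor R n d.+1) (U0 : 'M[R]_(n d.+1, r)) :
  (1 <= t <= d.+1)%N -> (r <= n d.+1)%N -> leading_left_vectors (unfold A) U0 ->
  Gmax r t A <= sum_sq_sing_val r (unfold A).
Proof.
move=> /andP[t1 td] hr hl.
have S0 : 0 <= sum_sq_sing_val r (unfold A).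
  by apply: sumr_ge0 => i _; exact: sqr_ge0.
rewrite /Gmax; set E := (X in sup X).
have [->|/set0P ne] := eqVneq E set0; first by rewrite sup0.
apply: ge_sup => // _ [U hU <-].
apply: le_trans (Gfun_le A t1 hU) _.
have [W [Z h]] := sing_val_svd hl.
apply: (ky_fan h hr); apply: hU.2; lia.
Qed.

(** * Stages without randomness *)

(** At [j = 1] the unfolding has a single column, namely the vector itself, so
    the general form [v = M y] holds there with [y = 1]. *)
Lemma stage_vectorP (R : realType) n m
    (proc : forall m p, 'M[R]_(m, p) -> 'cV[R]_m -> Prop) (T : tensor R n m.+1) v :
  (forall q p (M : 'M[R]_(q, p)) w, proc q p M w ->
     exists2 y, unit_vec y & w = M *m y) ->
  stage_vector proc T v -> exists2 y, unit_vec y & v = unfold T *m y.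
Proof.
move=> hp; case: m T v => [|m] T v /=; last exact: hp.
move=> ->; exists (const_mx 1).
  apply/unit_vec_sqnorm; rewrite sqnorm_col.
  under eq_bigr do rewrite mxE expr1n.
  by rewrite sumr_const card_ord card_unit.
apply/colP => a; rewrite !mxE.
have e0 : #|{: midx n 0}| = 1%N by rewrite card_unit.
rewrite (bigD1 (cast_ord (esym e0) 0))//= big1 => [|c].
  by rewrite !mxE addr0 mulr1; congr T; congr pair; case: (enum_val _).
by case/eqP; apply: val_inj => /=; have := ltn_ord c; rewrite [X in (_ < X)%N]e0; case: (val c).
Qed.

Lemma stage_progress (R : realType) n m r (V U : 'M[R]_(n m.+1, r))
    (proc : 'I_r -> forall m p, 'M[R]_(m, p) -> 'cV[R]_m -> Prop)
    (B : 'I_r -> tensor R n m.+1) :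
  (0 < r)%N ->
  (forall i q p (M : 'M[R]_(q, p)) w, proc i q p M w ->
     exists2 y, unit_vec y & w = M *m y) ->
  (forall i, stage_vector (proc i) (B i) (col i V)) -> polar_factor V U ->
  r%:R^-1 * sqnorm V <=
    \sum_i tinner (Defs.contract (B i) (col i U)) (Defs.contract (B i) (col i U)).
Proof.
move=> hr hp hst hpol.
have /choice[y hy] : forall i, exists y, unit_vec y /\ col i V = unfold (B i) *m y.
  by move=> i; have [y] := stage_vectorP (hp i) (hst i); exists y.
have := polar_factor_gain hr hpol (fun i => (hy i).1) (fun i => (hy i).2).
by under [X in _ <= X -> _]eq_bigr do rewrite -tinner_contract.
Qed.

Lemma procAB_unit (R : realType) q p (M : 'M[R]_(q, p)) w :
  procA M w \/ procB M w -> exists2 y, unit_vec y & w = M *m y.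
Proof.
case=> [[y [hy ->]]|[k [y [_ _ hy ->]]]]; exists y => //.
  by have [] := leading_right_bound hy.
by have [] := row_direction_bound hy.
Qed.

Lemma procC_unit (R : realType) kbar q p (M : 'M[R]_(q, p)) w :
  procC kbar M w -> exists2 y, unit_vec y & w = M *m y.
Proof. by move=> [k [y [_ hy ->]]]; exists y => //; have [] := row_direction_bound hy. Qed.

Lemma procAB_bound (R : realType) q p (M : 'M[R]_(q, p)) w :
  procA M w \/ procB M w -> q%:R^-1 * sqnorm M <= sqnorm w.
Proof.
case=> [[y [hy ->]]|[k [y [hk _ hy ->]]]].
  by have [] := leading_right_bound hy.
have [_] := row_direction_bound hy; apply: le_trans; exact: longest_row_bound.
Qed.

Lemma stage1_sqnorm (R : realType) n (T : tensor R n 1) :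
  sqnorm (vec_of_tensor T) = tinner T T.
Proof.
rewrite sqnorm_col /tinner big_midxS big_midx0.
by apply: eq_bigr => a _; rewrite mxE expr2.
Qed.

Lemma stage_AB_bound (R : realType) n m (T : tensor R n m.+1) v :
  stage_vector (fun m p M v => procA M v \/ procB M v) T v ->
  stage_beta R n m.+1 * tinner T T <= sqnorm v.
Proof.
case: m T v => [|m] T v; rewrite /stage_beta/=.
  by move=> ->; rewrite mul1r stage1_sqnorm.
by move=> /procAB_bound; rewrite tinner_unfold.
Qed.

(** Indexed by a natural number, as are the random draws, so that it can be
    evaluated at a draw without a proof that the draw is in range. *)
Definition slice_sq (R : realType) n m (T : tensor R n m) (a : nat) : R :=
  \sum_(k < n m | k == a :> nat) sqnorm (row k (unfold T)).

Lemma slice_sq_ge0 (R : realType) n m (T : tensor R n m) a : 0 <= slice_sq T a.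
Proof. by apply: sumr_ge0 => k _; exact: sqnorm_ge0. Qed.

Lemma sum_slice_sq (R : realType) n m (T : tensor R n m.+1) :
  \sum_(a < n m.+1) slice_sq T a = tinner T T.
Proof.
rewrite tinner_unfold sqnorm_sum_row; apply: eq_bigr => a _.
by rewrite /slice_sq (big_pred1 a).
Qed.

Lemma stage_C_bound (R : realType) n m kbar (T : tensor R n m.+2) v :
  stage_vector (fun m p M v => procC kbar M v) T v ->
  (kbar < n m.+2)%N /\ slice_sq T kbar <= sqnorm v.
Proof.
move=> [k [y [<- hy ->]]]; split; first exact: ltn_ord.
rewrite /slice_sq (big_pred1 k) ?(row_direction_bound hy).2//.
Qed.

Lemma tinner0_sqr (R : realType) n u (T : tensor R n 0) : tinner T T = tinner T (rank1 u 0) ^+ 2.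
Proof. by rewrite /tinner !big_midx0 mulr1 expr2. Qed.

Lemma rank1approx_sqr (R : realType) n m (zeta : R)
    (x : tensor R n m -> forall j, 'cV[R]_(n j)) (T : tensor R n m) :
  rank1approx_guarantee zeta x ->
  1 / zeta ^+ 2 * tinner T T <= tinner T (rank1 (x T) m) ^+ 2.
Proof.
move=> [/andP[z0 _] /(_ T) [_ h]].
rewrite mul1r -exprVn -[tinner T T](sqr_sqrtr (tinner_ge0 T)) -exprMn mulrC.
by rewrite ler_sqr// nnegrE ?(le_trans _ h)// mulr_ge0 ?sqrtr_ge0// ltW.
Qed.

Lemma Gfun_contracted (R : realType) n d r (A : tensor R n d)
    (U : forall j, 'M[R]_(n j, r)) (B : forall j, 'I_r -> tensor R n j) m i :
  (forall i, B d i = A) ->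
  (forall j i, (j < d)%N -> B j i = Defs.contract (B j.+1 i) (col i (U j.+1))) ->
  (m <= d)%N ->
  tinner A (rank1 (fun j => col i (U j)) d) =
  tinner (B m i) (rank1 (fun j => col i (U j)) m).
Proof.
move=> hA hB /subnKC; move: (d - m)%N => k; elim: k m => [|k ih] m e.
  by rewrite addn0 in e; subst m; rewrite hA.
by rewrite (ih m.+1) ?addSnnS// tinner_rank1S -hB// -e addnS ltnS leq_addr.
Qed.

(** Stated in the extended reals so that it serves both for the deterministic
    quantities and for their expectations. *)
Lemma le_chain_prod (R : realType) (F : nat -> \bar R) (c : nat -> R) (a b : nat) :
  (a <= b)%N -> (forall j, (a <= j < b)%N -> 0 <= c j) ->
  (forall j, (a <= j < b)%N -> ((c j)%:E * F j <= F j.-1)%E) ->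
  ((\prod_(a <= j < b) c j)%:E * F b.-1 <= F a.-1)%E.
Proof.
move=> /subnKC <-; elim: (b - a)%N => [|k ih] hc hF.
  by rewrite addn0 big_geq// mul1e.
rewrite addnS big_nat_recr/= ?leq_addr// EFinM -muleA.
apply: le_trans (ih _ _); last 2 first.
- by move=> j /andP[aj jb]; apply: hc; rewrite aj addnS ltnW.
- by move=> j /andP[aj jb]; apply: hF; rewrite aj addnS ltnW.
apply: lee_wpmul2l; last by apply: hF; rewrite leq_addr addnS ltnSn.
rewrite lee_fin big_seq_cond; apply: prodr_ge0 => j; rewrite mem_index_iota andbT => /andP[aj jb].
by apply: hc; rewrite aj addnS ltnW.
Qed.

Lemma stage_beta_ge0 (R : realType) n j : 0 <= stage_beta R n j.
Proof. by rewrite /stage_beta; case: ifP. Qed.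

Lemma approx_ratio_ge0 (R : realType) n d r t (zeta : nat -> R) :
  0 <= approx_ratio n d r t zeta.
Proof.
rewrite /approx_ratio mulr_ge0 ?divr_ge0 ?sqr_ge0//.
by apply: prodr_ge0 => j _; rewrite divr_ge0 ?stage_beta_ge0.
Qed.

(** The quantity that the stages keep large: after the first contraction it is
    the sum of the [r] largest squared singular values, and at the end it bounds
    the objective from below. *)
Definition mass (R : realType) n r j (B : 'I_r -> tensor R n j) : R :=
  \sum_i tinner (B i) (B i).

Lemma mass_ge0 (R : realType) n r j (B : 'I_r -> tensor R n j) : 0 <= mass B.
Proof. by apply: sumr_ge0 => i _; exact: tinner_ge0. Qed.

Definition contraction_chain (R : realType) n d r (A : tensor R n d)
    (U : forall j, 'M[R]_(n j, r)) (B : forall j, 'I_r -> tensor R n j) : Prop :=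
  (forall i, B d i = A) /\
  (forall j i, (j < d)%N -> B j i = Defs.contract (B j.+1 i) (col i (U j.+1))).

Lemma mass_first (R : realType) n d r (A : tensor R n d.+1) U B :
  (r <= n d.+1)%N -> contraction_chain (r := r) A U B ->
  leading_left_vectors (unfold A) (U d.+1) ->
  mass (B d) = sum_sq_sing_val r (unfold A).
Proof.
move=> hr [hA hB] hl; rewrite -(sqnorm_leading_left hr hl) -sum_tinner_contract.
by apply: eq_bigr => i _; rewrite hB// hA.
Qed.

Lemma Gfun_ge_mass (R : realType) n d t r (A : tensor R n d) (zeta : nat -> R)
    (rk1 : forall m, tensor R n m -> forall j, 'cV[R]_(n j)) U B :
  (1 <= t <= d)%N -> zeta 0%N = 1 ->
  (forall m, (1 <= m <= d)%N -> rank1approx_guarantee (zeta m) (rk1 m)) ->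
  contraction_chain (r := r) A U B ->
  ((t < d)%N -> forall i j, (1 <= j <= d - t)%N ->
          col i (U j) = rk1 (d - t)%N (B (d - t)%N i) j) ->
  1 / zeta (d - t)%N ^+ 2 * mass (B (d - t)%N) <= Gfun A U.
Proof.
move=> htd z0 hz [hA hB] hU; rewrite /mass big_distrr; apply: ler_sum => i _ /=.
rewrite (@Gfun_contracted _ _ _ _ A U B (d - t)%N)// ?leq_subr//.
have [td|dt] := ltnP t d; last first.
  (* All modes are contracted and the tensor is a scalar: [d <= t] unfolds to
     [d - t == 0]. *)
  move/eqP: dt => /= dt; move: (B (d - t)%N i); rewrite dt => T.
  by rewrite z0 expr1n divr1 mul1r (tinner0_sqr (fun j => col i (U j))).
have hdt : (1 <= d - t <= d)%N by lia.
apply: le_trans (rank1approx_sqr _ (hz _ hdt)) _.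
by rewrite (eq_rank1 (v := fun j => col i (U j)))// => j hj; rewrite hU.
Qed.

Lemma mass_stage_AB (R : realType) n r j (U V : 'M[R]_(n j.+1, r)) (B : 'I_r -> tensor R n j.+1) :
  (0 < r)%N ->
  (forall i, stage_vector (fun m p M v => procA M v \/ procB M v) (B i) (col i V)) ->
  polar_factor V U ->
  stage_beta R n j.+1 / r%:R * mass B <=
  mass (fun i => Defs.contract (B i) (col i U)).
Proof.
move=> hr hV hpol; apply: le_trans (stage_progress hr _ hV hpol); last first.
  by move=> _ q p M w; exact: procAB_unit.
rewrite mulrAC mulrC ler_wpM2l ?invr_ge0// sqnorm_sum_col /mass big_distrr.
by apply: ler_sum => i _; exact: stage_AB_bound.
Qed.

(** * Integrals of functions of finitely many outcomes *)

(** Outside the range of [X], [g] is set to 0 so as to be nonnegative everywhere. *)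
Lemma factor_through (T : Type) (R : realType) (K : Type) (X : T -> K) (f : T -> R) :
  (forall w w', X w = X w' -> f w = f w') -> (forall w, 0 <= f w) ->
  exists2 g : K -> R, (forall x, 0 <= g x) & f = g \o X.
Proof.
move=> hf f0.
exists (fun x => if pselect (exists w, X w = x) is left e then f (projT1 (cid e)) else 0).
  by move=> x; case: pselect.
apply/funext => w /=; case: pselect => [e|]; last by case; exists w.
by apply: hf; case: cid.
Qed.

Lemma measurable_fiber (disp : measure_display) (T : measurableType disp) (K : Type)
    (X : T -> K) x :
  (forall w0, measurable [set w | X w = X w0]) -> measurable [set w | X w = x].
Proof.
move=> mX; have [[w <-]|h] := pselect (exists w, X w = x); first exact: mX.
rewrite (_ : mkset _ = set0)//; apply/seteqP; split => // w /= e.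
by apply: h; exists w.
Qed.

Lemma factor_indicE (T : Type) (R : realType) (K : finType) (X : T -> K) (g : K -> R) D w :
  g (X w) * \1_D w = \sum_x g x * \1_([set w | X w = x] `&` D) w.
Proof.
rewrite (bigD1 (X w))//= big1 => [|x /eqP hx].
  by rewrite addr0 !indicE in_setI (_ : (w \in [set _ | _]) = true)// mem_set.
rewrite indicE in_setI memNset ?mulr0//= => e; exact: hx.
Qed.

Lemma measurable_factor (disp : measure_display) (T : measurableType disp) (R : realType)
    (K : finType) (X : T -> K) (f : T -> R) (D : set T) :
  (forall w0, measurable [set w | X w = X w0]) -> measurable D ->
  (forall w w', X w = X w' -> f w = f w') -> (forall w, 0 <= f w) ->
  measurable_fun setT (fun w => f w * \1_D w).
Proof.
move=> mX mD hf f0; have [g g0 ->] := factor_through hf f0.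
rewrite (_ : (fun w => _) = fun w => \sum_x g x * \1_([set w | X w = x] `&` D) w); last first.
  by apply/funext => w; exact: factor_indicE.
apply: measurable_sum => x; apply: measurable_funM => //; apply: measurable_indic.
by apply: measurableI => //; exact: measurable_fiber.
Qed.

(** [X] takes finitely many values, so the integrand is a finite combination of
    indicators of measurable sets. *)
Lemma integral_factor (disp : measure_display) (T : measurableType disp) (R : realType)
    (P : probability T R) (K : finType) (X : T -> K) (g : K -> R) (D : set T) :
  (forall w0, measurable [set w | X w = X w0]) -> measurable D -> (forall x, 0 <= g x) ->
  (\int[P]_w (g (X w) * \1_D w)%:E = \sum_x (g x)%:E * P ([set w | X w = x] `&` D))%E.
Proof.
move=> mX mD g0.
have mF x : measurable ([set w | X w = x] `&` D)%classic.
  by apply: measurableI => //; exact: measurable_fiber.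
under eq_integral do rewrite (factor_indicE X g) -sumEFin.
rewrite ge0_integral_sum//=; last 2 first.
- move=> x; apply/measurable_EFinP; apply: measurable_funM => //; exact: measurable_indic.
- by move=> x w _; rewrite lee_fin mulr_ge0.
apply: eq_bigr => x _.
under eq_integral do rewrite EFinM.
rewrite ge0_integralZl//=; first by rewrite integral_indic// setIT.
- by apply/measurable_EFinP; exact: measurable_indic.
- by rewrite lee_fin.
Qed.

Lemma integral_indep_event (disp : measure_display) (T : measurableType disp) (R : realType)
    (P : probability T R) (K : finType) (X : T -> K) (f : T -> R) (D : set T) (q : R) :
  (forall w0, measurable [set w | X w = X w0]) -> measurable D -> 0 <= q ->
  (forall w0, P ([set w | X w = X w0] `&` D) = P [set w | X w = X w0] * q%:E)%E ->
  (forall w w', X w = X w' -> f w = f w') -> (forall w, 0 <= f w) ->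
  (\int[P]_w (f w * \1_D w)%:E = q%:E * \int[P]_w (f w)%:E)%E.
Proof.
move=> mX mD q0 hD hf f0; have [g g0 ->] := factor_through hf f0.
rewrite /= (integral_factor P mX mD g0).
have -> : (\int[P]_w (g (X w))%:E = \sum_x (g x)%:E * P [set w | X w = x])%E.
  have := integral_factor P mX measurableT g0.
  under eq_integral do rewrite indicT mulr1.
  by move=> ->; apply: eq_bigr => x _; rewrite setIT.
rewrite ge0_sume_distrr; last by move=> x _; rewrite mule_ge0// lee_fin.
apply: eq_bigr => x _.
have [[w0 <-]|h] := pselect (exists w, X w = x).
  by rewrite hD muleA muleC.
have -> : [set w | X w = x] = set0.
  by apply/seteqP; split => // w /= e; apply: h; exists w.
by rewrite set0I measure0 !mule0.
Qed.

(** Averaging over a uniform index: given the information [X], the index [kbar]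
    is uniform on [N] values, while each [f _ a] is a function of [X].  Splitting
    along the events [kbar = a] replaces the drawn term by the mean of all. *)
Lemma integral_uniform_pick (disp : measure_display) (T : measurableType disp) (R : realType)
    (P : probability T R) (K : finType) (X : T -> K) (kbar : T -> nat) (N : nat)
    (f : T -> nat -> R) :
  (forall w0, measurable [set w | X w = X w0]) ->
  (forall a, measurable [set w | kbar w = a]) ->
  (forall w, (kbar w < N)%N) ->
  (forall w0 a, (a < N)%N -> P ([set w | X w = X w0] `&` [set w | kbar w = a]) =
     P [set w | X w = X w0] * (N%:R^-1)%:E)%E ->
  (forall w w' a, X w = X w' -> f w a = f w' a) -> (forall w a, 0 <= f w a) ->
  measurable_fun setT (fun w => f w (kbar w)) /\
  (\int[P]_w (f w (kbar w))%:E =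
    (N%:R^-1)%:E * \int[P]_w (\sum_(a < N) f w a)%:E)%E.
Proof.
move=> mX mk kN hP hf f0.
have fE w : f w (kbar w) = \sum_(a < N) f w a * \1_([set w | kbar w = a]) w.
  rewrite (bigD1 (Ordinal (kN w)))//= big1 => [|a ha].
    by rewrite addr0 indicE mem_set// mulr1.
  rewrite indicE memNset ?mulr0//= => e; case/eqP: ha; exact: val_inj.
have mf a : measurable_fun setT (fun w => f w a * \1_([set w | kbar w = a]) w).
  by apply: (measurable_factor mX) => // w w' h; exact: hf.
have mf1 a : measurable_fun setT (f ^~ a).
  have := @measurable_factor _ _ R _ X (f ^~ a) setT mX measurableT.
  rewrite (_ : (fun w => _) = f ^~ a); last by apply/funext => w; rewrite indicT mulr1.
  by apply => // w w' h; exact: hf.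
split.
  rewrite (_ : (fun w => _) = fun w => \sum_(a < N) f w a * \1_([set w | kbar w = a]) w).
    by apply: measurable_sum => a.
  by apply/funext => w; exact: fE.
under eq_integral do rewrite fE -sumEFin.
rewrite ge0_integral_sum//=; last 2 first.
- by move=> a; apply/measurable_EFinP.
- by move=> a w _; rewrite lee_fin mulr_ge0.
under [in RHS]eq_integral do rewrite -sumEFin.
rewrite ge0_integral_sum//=; last 2 first.
- by move=> a; apply/measurable_EFinP.
- by move=> a w _; rewrite lee_fin.
rewrite ge0_sume_distrr; last by move=> a _; apply: integral_ge0 => w _; rewrite lee_fin.
apply: eq_bigr => a _; apply: (integral_indep_event mX) => //.
  by move=> w0; exact: hP.
by move=> w w' h; exact: hf.
Qed.

(** * Stages with random draws *)

Lemma mass_stage_C (R : realType) n j r (U V : 'M[R]_(n j.+2, r))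
    (B : 'I_r -> tensor R n j.+2) (kbar : 'I_r -> nat) :
  (0 < r)%N ->
  (forall i, stage_vector (fun m p M v => procC (kbar i) M v) (B i) (col i V)) ->
  polar_factor V U ->
  r%:R^-1 * (\sum_i slice_sq (B i) (kbar i)) <=
  mass (fun i => Defs.contract (B i) (col i U)).
Proof.
move=> hr hV hpol; apply: le_trans (stage_progress hr _ hV hpol); last first.
  by move=> i q p M w; exact: procC_unit.
rewrite ler_wpM2l ?invr_ge0// sqnorm_sum_col; apply: ler_sum => i _.
exact: (stage_C_bound (hV i)).2.
Qed.

Lemma mass_stage1 (R : realType) n r (U V : 'M[R]_(n 1, r))
    (B : 'I_r -> tensor R n 1) (kbar : 'I_r -> nat) :
  (0 < r)%N ->
  (forall i, stage_vector (fun m p M v => procC (kbar i) M v) (B i) (col i V)) ->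
  polar_factor V U ->
  r%:R^-1 * mass B <= mass (fun i => Defs.contract (B i) (col i U)).
Proof.
move=> hr hV hpol; apply: le_trans (stage_progress hr _ hV hpol); last first.
  by move=> i q p M w; exact: procC_unit.
rewrite ler_wpM2l ?invr_ge0// sqnorm_sum_col; apply: ler_sum => i _.
by have /= -> := hV i; rewrite stage1_sqnorm.
Qed.

(** The information available at stage [j], as an equivalence of outcomes: the
    draws of all earlier stages, which have larger indices, coincide. *)
Definition same_past (Omega : Type) (r d t j : nat) (kbar : nat -> 'I_r -> Omega -> nat)
    (w w' : Omega) : Prop :=
  forall j' i, (j < j')%N -> draw_stage d t j' -> kbar j' i w = kbar j' i w'.

Lemma draw_stage_lt d t j : draw_stage d t j -> (j < d)%N.
Proof. by rewrite /draw_stage; lia. Qed.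

(** The past can be recorded in a finite type because the draws are bounded,
    which reduces all integrals below to finite sums. *)
Lemma past_finite (Omega : Type) (r d t j : nat) (n : nat -> nat)
    (kbar : nat -> 'I_r -> Omega -> nat) :
  (forall w j i, draw_stage d t j -> (kbar j i w < n j)%N) ->
  exists (K : finType) (X : Omega -> K),
    forall w w', X w = X w' <-> same_past d t j kbar w w'.
Proof.
move=> hk; pose N := (\max_(k < d) n k)%N.
exists {ffun 'I_d * 'I_r -> 'I_N.+1}.
exists (fun w => [ffun p : 'I_d * 'I_r => if (j < p.1)%N && draw_stage d t p.1
   then inord (kbar p.1 p.2 w) else ord0]) => w w'; split.
  move=> /ffunP h j' i hj hd; have := h (Ordinal (draw_stage_lt hd), i).
  rewrite !ffunE /= hj hd /= => /(congr1 val).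
  have hN v : (kbar j' i v < N.+1)%N.
    rewrite ltnS (leq_trans (ltnW (hk v _ _ hd)))//.
    exact: (leq_bigmax (Ordinal (draw_stage_lt hd))).
  by rewrite /= !inordK.
move=> h; apply/ffunP => p; rewrite !ffunE; case: ifP => // /andP[hj hd].
by rewrite h.
Qed.

Lemma measurable_past (R : realType) (disp : measure_display)
    (Omega : measurableType disp) (P : probability Omega R) (r d t j : nat)
    (kbar : nat -> 'I_r -> {RV P >-> nat}) (w0 : Omega) :
  measurable [set w | same_past d t j (fun j i => kbar j i : Omega -> nat) w w0].
Proof.
pose F (p : 'I_d * 'I_r) : set Omega := if (j < p.1)%N && draw_stage d t p.1
  then kbar p.1 p.2 @^-1` [set kbar p.1 p.2 w0] else setT.
rewrite (_ : mkset _ = \bigcap_(p in [set: 'I_d * 'I_r]) F p).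
  apply: fin_bigcap_measurable => // p _; rewrite /F; case: ifP => // _.
  by rewrite -[X in measurable X]setTI; exact: measurable_funPT.
apply/seteqP; split => w.
  by move=> h p _; rewrite /F; case: ifP => //= /andP[hj hd]; exact: h.
move=> h j' i hj hd; have := h (Ordinal (draw_stage_lt hd), i) I.
by rewrite /F /= hj hd.
Qed.

Lemma measurable_past_fun (R : realType) (disp : measure_display)
    (Omega : measurableType disp) (P : probability Omega R) (n : nat -> nat)
    (r d t j : nat) (kbar : nat -> 'I_r -> {RV P >-> nat}) (f : Omega -> R) :
  (forall w j i, draw_stage d t j -> (kbar j i w < n j)%N) ->
  (forall w w', same_past d t j (fun j i => kbar j i : Omega -> nat) w w' -> f w = f w') ->
  (forall w, 0 <= f w) ->
  measurable_fun setT f.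
Proof.
move=> kbar_lt hf f0.
have [K [X hX]] := past_finite (kbar := fun j i => kbar j i : Omega -> nat) j kbar_lt.
rewrite (_ : f = fun w => f w * \1_setT w); last first.
  by apply/funext => w; rewrite indicT mulr1.
apply: (measurable_factor (X := X)) => //.
  move=> w0; rewrite (_ : mkset _ =
    [set w | same_past d t j (fun j i => kbar j i : Omega -> nat) w w0]).
    exact: measurable_past.
  by apply/seteqP; split => w /hX.
by move=> w w' /hX; exact: hf.
Qed.

Lemma expect_draw (R : realType) (disp : measure_display)
    (Omega : measurableType disp) (P : probability Omega R) (n : nat -> nat)
    (r d t j : nat) (i : 'I_r) (kbar : nat -> 'I_r -> {RV P >-> nat})
    (f : Omega -> nat -> R) :
  (forall w j i, draw_stage d t j -> (kbar j i w < n j)%N) ->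
  uniform_draws n d t kbar -> draw_stage d t j ->
  (forall w w' a, same_past d t j (fun j i => kbar j i : Omega -> nat) w w' -> f w a = f w' a) ->
  (forall w a, 0 <= f w a) ->
  measurable_fun setT (fun w => f w (kbar j i w)) /\
  (\int[P]_w (f w (kbar j i w))%:E =
    ((n j)%:R^-1)%:E * \int[P]_w (\sum_(a < n j) f w a)%:E)%E.
Proof.
move=> kbar_lt kbar_unif hd hf f0.
have [K [X hX]] := past_finite (kbar := fun j i => kbar j i : Omega -> nat) j kbar_lt.
have XE w0 : [set w | X w = X w0] =
    [set w | same_past d t j (fun j i => kbar j i : Omega -> nat) w w0].
  by apply/seteqP; split => w /hX.
apply: (integral_uniform_pick (X := X)) => //.
- by move=> w0; rewrite XE; exact: measurable_past.
- move=> a; rewrite (_ : mkset _ = kbar j i @^-1` [set a])//.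
  by rewrite -[X in measurable X]setTI; exact: measurable_funPT.
- by move=> w; exact: kbar_lt.
- move=> w0 a ha; rewrite XE; exact: (kbar_unif _ i (fun j' i' => kbar j' i' w0) _ hd ha).
- by move=> w w' a /hX; exact: hf.
Qed.

Lemma integral_scale_le (R : realType) (disp : measure_display)
    (Omega : measurableType disp) (P : probability Omega R) (c : R) (f g : Omega -> R) :
  0 <= c -> measurable_fun setT f -> measurable_fun setT g ->
  (forall w, 0 <= f w) -> (forall w, c * f w <= g w) ->
  (c%:E * \int[P]_w (f w)%:E <= \int[P]_w (g w)%:E)%E.
Proof.
move=> c0 mf mg f0 fg.
rewrite -ge0_integralZl//=; last 2 first.
- by apply/measurable_EFinP.
- by move=> w _; rewrite lee_fin.
under eq_integral do rewrite -EFinM.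
apply: ge0_le_integral => //.
- by move=> w _; rewrite lee_fin mulr_ge0.
- by apply/measurable_EFinP; exact: measurable_funM.
- by apply/measurable_EFinP.
- by move=> w _; rewrite lee_fin.
Qed.

Lemma integral_sum_fin (R : realType) (disp : measure_display)
    (Omega : measurableType disp) (P : probability Omega R) (r : nat) (f : 'I_r -> Omega -> R) :
  (forall i, measurable_fun setT (f i)) -> (forall i w, 0 <= f i w) ->
  (\int[P]_w (\sum_i f i w)%:E = \sum_i \int[P]_w (f i w)%:E)%E.
Proof.
move=> mf f0; under eq_integral do rewrite -sumEFin.
rewrite ge0_integral_sum//=; first by move=> i; exact/measurable_EFinP.
by move=> i w _; rewrite lee_fin.
Qed.

(** The drawn slice has, on average, a fraction [1 / n j] of the squared norm of
    the tensor, because the tensor is determined by the earlier draws. *)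
Lemma expected_mass_stage (R : realType) (disp : measure_display)
    (Omega : measurableType disp) (P : probability Omega R) (n : nat -> nat)
    (r d t m : nat) (kbar : nat -> 'I_r -> {RV P >-> nat})
    (B : Omega -> 'I_r -> tensor R n m.+2) (f : Omega -> R) :
  (forall w j i, draw_stage d t j -> (kbar j i w < n j)%N) ->
  uniform_draws n d t kbar -> draw_stage d t m.+2 ->
  (forall w w', same_past d t m.+2 (fun j i => kbar j i : Omega -> nat) w w' -> B w = B w') ->
  measurable_fun setT f ->
  (forall w, r%:R^-1 * (\sum_i slice_sq (B w i) (kbar m.+2 i w)) <= f w) ->
  ((stage_beta R n m.+2 / r%:R)%:E * \int[P]_w (mass (B w))%:E <= \int[P]_w (f w)%:E)%E.
Proof.
move=> kbar_lt hu hd hB mf hf.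
have hs i : measurable_fun setT (fun w => slice_sq (B w i) (kbar m.+2 i w)) /\
  (\int[P]_w (slice_sq (B w i) (kbar m.+2 i w))%:E =
    ((n m.+2)%:R^-1)%:E * \int[P]_w (\sum_(a < n m.+2) slice_sq (B w i) a)%:E)%E.
  apply: (expect_draw i (f := fun w a => slice_sq (B w i) a) kbar_lt hu hd).
    by move=> w w' a /hB ->.
  by move=> w a; exact: slice_sq_ge0.
have : ((r%:R^-1)%:E * \int[P]_w (\sum_i slice_sq (B w i) (kbar m.+2 i w))%:E <=
    \int[P]_w (f w)%:E)%E.
  apply: integral_scale_le => //.
    by apply: measurable_sum => i; exact: (hs i).1.
  by move=> w; apply: sumr_ge0 => i _; exact: slice_sq_ge0.
apply: le_trans; rewrite integral_sum_fin; last 2 first.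
- by move=> i; exact: (hs i).1.
- by move=> i w; exact: slice_sq_ge0.
rewrite integral_sum_fin; last 2 first.
- move=> i; apply: (measurable_past_fun (j := m.+2) kbar_lt) => [w w' /hB ->//|w].
  exact: tinner_ge0.
- by move=> i w; exact: tinner_ge0.
rewrite mulrC EFinM -muleA lee_wpmul2l ?lee_fin ?invr_ge0//.
rewrite ge0_sume_distrr; last by move=> i _; apply: integral_ge0 => w _; rewrite lee_fin tinner_ge0.
rewrite le_eqVlt; apply/orP; left; apply/eqP; apply: eq_bigr => i _.
rewrite (hs i).2; congr (_ * _)%E; apply: eq_integral => w _.
by rewrite sum_slice_sq.
Qed.

(** The contraction at level [j] only involves the factors of the modes above
    [j], which were computed from the draws made before stage [j]. *)
Lemma contraction_chain_past (R : realType) (Omega : Type) (n : nat -> nat)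
    (d t r : nat) (A : tensor R n d) (kbar : nat -> 'I_r -> Omega -> nat)
    (U : Omega -> forall j, 'M[R]_(n j, r)) (B : Omega -> forall j, 'I_r -> tensor R n j) :
  (forall w, contraction_chain A (U w) (B w)) ->
  (forall j w w', (d - t + 1 <= j <= d)%N ->
     (forall j' i, (j <= j')%N -> draw_stage d t j' -> kbar j' i w = kbar j' i w') ->
     U w j = U w' j) ->
  forall j w w', (d - t <= j <= d)%N -> same_past d t j kbar w w' -> B w j = B w' j.
Proof.
move=> hB hU j w w' /andP[hj /subnKC]; move: (d - j)%N => k.
elim: k j hj => [|k ih] j hj e hp.
  by rewrite addn0 in e; subst j; apply/funext => i; rewrite !(hB _).1.
have hjd : (j < d)%N by lia.
apply/funext => i; rewrite ((hB w).2 j i hjd) ((hB w').2 j i hjd).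
rewrite (ih j.+1); [|lia|lia|].
  rewrite (hU j.+1 w w')//; first by lia.
by move=> j' i' hj'; apply: hp; exact: ltnW.
Qed.

(** * Objective, ratio and conclusion *)

(** The remaining factors are computed from the last contractions, so the
    objective is a function of these alone; in the random case this makes it
    measurable. *)
Lemma eq_Gfun (R : realType) n d t r (A : tensor R n d)
    (rk1 : forall m, tensor R n m -> forall j, 'cV[R]_(n j)) U B U' B' :
  (t <= d)%N -> contraction_chain (r := r) A U B -> contraction_chain A U' B' ->
  ((t < d)%N -> forall i j, (1 <= j <= d - t)%N ->
     col i (U j) = rk1 (d - t)%N (B (d - t)%N i) j) ->
  ((t < d)%N -> forall i j, (1 <= j <= d - t)%N ->
     col i (U' j) = rk1 (d - t)%N (B' (d - t)%N i) j) ->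
  B (d - t)%N = B' (d - t)%N -> Gfun A U = Gfun A U'.
Proof.
move=> td [hA hB] [hA' hB'] hU hU' e; apply: eq_bigr => i _; congr (_ ^+ 2).
rewrite (Gfun_contracted i hA hB (leq_subr t d)) (Gfun_contracted i hA' hB' (leq_subr t d)).
rewrite e; congr tinner; apply: eq_rank1 => j hj.
have td' : (t < d)%N by lia.
by rewrite hU// hU'// e.
Qed.

Lemma approx_ratioE (R : realType) (n : nat -> nat) (d r t : nat) (zeta : nat -> R) :
  (1 <= t < d)%N ->
  approx_ratio n d r t zeta = 1 / (r%:R ^+ (t - 1) * zeta (d - t)%N ^+ 2 *
                                \prod_(d - t + 1 <= j < d) (n j)%:R).
Proof.
move=> htd; rewrite /approx_ratio big_split /= prodr_const_nat.
rewrite (_ : (d - (d - t + 1) = t - 1)%N); last by lia.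
rewrite (eq_big_nat _ _ (F2 := fun j => (n j)%:R^-1)); last first.
  by move=> j hj; rewrite /stage_beta ifN_eqC//; lia.
rewrite prodfV exprVn !div1r.
move: (r%:R ^+ _) (zeta _ ^+ 2) (\prod_(_ <= _ < _) _) => x y z.
by rewrite !invfM; ring.
Qed.

Lemma approx_ratio_full (R : realType) (n : nat -> nat) (d r : nat) (zeta : nat -> R) :
  (2 <= d)%N -> zeta 0%N = 1 ->
  approx_ratio n d r d zeta = 1 / (r%:R ^+ (d - 1) * \prod_(2 <= j < d) (n j)%:R).
Proof.
move=> hd z0; rewrite /approx_ratio subnn z0 expr1n divr1 mul1r add0n.
rewrite big_split /= prodr_const_nat big_ltn//.
rewrite (eq_big_nat _ _ (F2 := fun j => (n j)%:R^-1)); last first.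
  by move=> j hj; rewrite /stage_beta ifN_eqC//; lia.
rewrite prodfV exprVn {1}/stage_beta eqxx !div1r.
move: (r%:R ^+ _) (\prod_(_ <= _ < _) _) => x y.
by rewrite !invfM; ring.
Qed.

Theorem theorem4p1 (R : realType) (d t r : nat) (n : nat -> nat)
    (A : tensor R n d) (zeta : nat -> R)
    (rk1 : forall m, tensor R n m -> forall j, 'cV[R]_(n j))
    (hd : (3 <= d)%N) (ht : (1 <= t <= d)%N) (hr : (1 <= r)%N)
    (hn : forall j, (1 <= j <= d)%N -> (1 <= n j)%N)
    (hrn : forall j, (d - t + 1 <= j <= d)%N -> (r <= n j)%N)
    (hzeta0 : zeta 0%N = 1)
    (hrk1 : forall m, (1 <= m <= d)%N ->
       rank1approx_guarantee (zeta m) (rk1 m)) :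
  let ratio := approx_ratio n d r t zeta in
  let S := sum_sq_sing_val r (unfold A) in
  [/\ (* (i) *)
      forall U : (forall j, 'M[R]_(n j, r)),
        algorithm1 t A rk1 (fun _ _ m p M v => procA M v \/ procB M v) U ->
        Gfun A U >= ratio * S /\ ratio * S >= ratio * Gmax r t A,
      (* (ii) *)
      forall (disp : measure_display) (Omega : measurableType disp)
          (P : probability Omega R) (kbar : nat -> 'I_r -> {RV P >-> nat})
          (U : Omega -> forall j, 'M[R]_(n j, r)),
        uniform_draws n d t kbar ->
        nonanticipative d t kbar U ->
        (forall w, algorithm1 t A rk1
           (fun j i m p M v => procC (kbar j i w) M v) (U w)) ->
        ('E_P[fun w => Gfun A (U w)] >= (ratio * S)%:E)%E /\
        ratio * S >= ratio * Gmax r t A,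
      (* the value of the ratio *)
      t = d -> ratio = 1 / (r%:R ^+ (d - 1) * \prod_(2 <= j < d) (n j)%:R) &
      (t < d)%N -> ratio = 1 / (r%:R ^+ (t - 1) * zeta (d - t)%N ^+ 2 *
                                \prod_(d - t + 1 <= j < d) (n j)%:R)].
Proof.
move=> ratio S.
have hratio : 0 <= ratio by exact: approx_ratio_ge0.
case: d A hd ht hn hrn hrk1 @ratio @S hratio => // d A hd ht hn hrn hrk1 ratio S hratio.
have hrd : (r <= n d.+1)%N by apply: hrn; lia.
have hG (U : forall j, 'M[R]_(n j, r)) :
    leading_left_vectors (unfold A) (U d.+1) -> ratio * Gmax r t A <= ratio * S.
  by move=> hl; rewrite ler_wpM2l// (Gmax_le ht hrd hl).
(* Both parts reduce to a sequence [F], the mass or its expectation, that starts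
   at [S], loses at most [stage_beta n j / r] at stage [j], and is finally
   compared with the objective. *)
have hchain (F : nat -> \bar R) (x : \bar R) : F d = S%:E ->
    (forall j, (d.+1 - t + 1 <= j < d.+1)%N ->
      ((stage_beta R n j / r%:R)%:E * F j <= F j.-1)%E) ->
    ((1 / zeta (d.+1 - t)%N ^+ 2)%:E * F (d.+1 - t)%N <= x)%E ->
    ((ratio * S)%:E <= x)%E.
  move=> hF hs; move=> hx; apply: le_trans hx.
  rewrite /ratio /approx_ratio 2!EFinM -muleA lee_wpmul2l ?lee_fin ?divr_ge0 ?sqr_ge0//.
  have := @le_chain_prod R F (fun j => stage_beta R n j / r%:R) (d.+1 - t + 1) d.+1.
  rewrite /= hF addn1 /= => h; apply: h; first by lia.
    by move=> j _; rewrite divr_ge0 ?stage_beta_ge0.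
  by rewrite -addn1.
split.
- move=> U [B [[hB1 hB2] hl hst hfin]]; split; last exact: hG hl.
  have hB : contraction_chain A U B by [].
  rewrite -lee_fin; apply: (hchain (fun j => (mass (B j))%:E)).
  + by rewrite (mass_first hrd hB hl).
  + move=> [|j] hj; first by lia.
    have [|V [hV hpol]] := hst j.+1; first by lia.
    rewrite -EFinM lee_fin (_ : B j.+1.-1 = fun i => Defs.contract (B j.+1 i) (col i (U j.+1))).
      exact: mass_stage_AB hr hV hpol.
    by apply/funext => i; rewrite hB2//; lia.
  + by rewrite -EFinM lee_fin; apply: Gfun_ge_mass hzeta0 hrk1 hB hfin.
- move=> disp Omega P kbar U hunif hna halg.
  (* The outcome space has total mass 1, so it is inhabited; any outcome yields
     the singular value decomposition needed for the second inequality. *)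
  have [w0 _] : exists w : Omega, True.
    apply: contrapT => h; have := probability_setT P.
    rewrite (_ : setT = set0) ?measure0; last by apply/seteqP; split => // w _; apply: h; exists w.
    by move=> [] /eqP; rewrite eq_sym oner_eq0.
  split; last by have [? [_ hl _ _]] := halg w0; exact: hG hl.
  have [B hBall] := choice halg.
  have hB w : contraction_chain A (U w) (B w) by have [[]] := hBall w.
  have hl w : leading_left_vectors (unfold A) (U w d.+1) by have [] := hBall w.
  have hnext w j : (j < d.+1)%N ->
      B w j = fun i => Defs.contract (B w j.+1 i) (col i (U w j.+1)).
    by move=> hj; apply/funext => i; rewrite (hB w).2.
  have kbar_lt w j i : draw_stage d.+1 t j -> (kbar j i w < n j)%N.
    rewrite /draw_stage; case: j => [//|[//|j]] /andP[_ hj].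
    have [_ _ /(_ _ hj) [V [hV _]] _] := hBall w.
    exact: (stage_C_bound (hV i)).1.
  have hpast := contraction_chain_past hB hna.
  have mmass j : (d.+1 - t <= j <= d.+1)%N -> measurable_fun setT (fun w => mass (B w j)).
    move=> hj; apply: (measurable_past_fun (j := j) kbar_lt) => [w w' h|w].
      by rewrite (hpast j w w' hj h).
    exact: mass_ge0.
  rewrite unlock; apply: (hchain (fun j => \int[P]_w (mass (B w j))%:E)%E).
  + under eq_integral do rewrite (mass_first hrd (hB _) (hl _)).
    by rewrite integral_cst//= probability_setT mule1.
  + move=> [|j] hj; first by lia.
    case: j hj => [|j] hj.
      apply: integral_scale_le; rewrite ?divr_ge0 ?stage_beta_ge0//.
      * by apply: mmass; lia.
      * by apply: mmass; lia.
      * by move=> w; exact: mass_ge0.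
      * move=> w; have h1 : (d.+1 - t + 1 <= 1 <= d.+1 - 1)%N by lia.
        have [_ _ /(_ 1%N h1) [V [hV hpol]] _] := hBall w.
        rewrite /stage_beta eqxx div1r /= (hnext w 0%N)//.
        exact: (mass_stage1 (kbar := fun i => kbar 1%N i w) hr hV hpol).
    apply: (expected_mass_stage kbar_lt hunif).
    * by rewrite /draw_stage; lia.
    * by move=> w w' /hpast -> //; lia.
    * by apply: mmass => /=; lia.
    * move=> w; have hj2 : (d.+1 - t + 1 <= j.+2 <= d.+1 - 1)%N by lia.
      have [_ _ /(_ _ hj2) [V [hV hpol]] _] := hBall w.
      rewrite /= (hnext w j.+1); last by lia.
      exact: (mass_stage_C (kbar := fun i => kbar j.+2 i w) hr hV hpol).
  + have hGm w : 1 / zeta (d.+1 - t)%N ^+ 2 * mass (B w (d.+1 - t)%N) <= Gfun A (U w).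
      by have [_ _ _ hfin] := hBall w; exact: Gfun_ge_mass hzeta0 hrk1 (hB w) hfin.
    apply: integral_scale_le => //.
    * by rewrite divr_ge0 ?sqr_ge0.
    * by apply: mmass; lia.
    * apply: (measurable_past_fun (j := (d.+1 - t)%N) kbar_lt) => [w w' h|w]; last first.
        by apply: sumr_ge0 => i _; exact: sqr_ge0.
      have [_ _ _ hfin] := hBall w; have [_ _ _ hfin'] := hBall w'.
      apply: (eq_Gfun _ (hB w) (hB w') hfin hfin'); first by case/andP: ht.
      by apply: hpast => //; lia.
    * by move=> w; exact: mass_ge0.
- by move=> e; subst t; apply: approx_ratio_full hzeta0; exact: ltnW.
- by move=> e; apply: approx_ratioE; lia.
Qed.
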